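(* Let $I\subseteq(0,\infty)$ be an interval, let $f:I\to(0,\infty)$ be differentiable on the interior $I^{\circ}$ of $I$, let $a,b\in I^{\circ}$ with $a<b$, and suppose $f'\in L[a,b]$. Let $q>1$ and $s\in(0,1]$, and suppose that $|f'|^{q}$ is $s$-geometrically convex on $[a,b]$. Then $$\left|\frac{f(a)+f(b)}{2}-\frac{1}{\ln b-\ln a}\int_a^b\frac{f(x)}{x}\,dx\right|\le \frac12\ln\left(\frac{b}{a}\right)\left(\frac{q-1}{2q-1}\right)^{1-\frac1q}H_2\bigl(s,q;g_2(\theta_1),g_2(\theta_2)\bigr)$$ and $$\left|f\left(\sqrt{ab}\right)-\frac{1}{\ln b-\ln a}\int_a^b\frac{f(x)}{x}\,dx\right|\le \frac14\ln\left(\frac{b}{a}\right)\left(\frac{q-1}{2q-1}\right)^{1-\frac1q}H_2\bigl(s,q;g_2(\theta_3),g_2(\theta_4)\bigr),$$ where, for $u>0$, $$g_2(u)=\begin{cases}1, & u=1,\\[2pt] \dfrac{u-1}{\ln u}, & u\neq 1,\end{cases}$$ $$\theta_1=\left(\frac{b|f'(b)|^{s}}{a|f'(a)|^{s}}\right)^{q},\quad \theta_2=\left(\frac{a|f'(a)|^{s}}{b|f'(b)|^{s}}\right)^{q},\quad \theta_3=\sqrt{\theta_1},\quad \theta_4=\sqrt{\theta_2},$$ and, for $(i,j)=(1,2)$ and $(i,j)=(3,4)$, $$H_2\bigl(s,q;g_2(\theta_i),g_2(\theta_j)\bigr)=\begin{cases} a|f'(a)|^{s}g_2(\theta_i)^{1/q}+b|f'(b)|^{s}g_2(\theta_j)^{1/q},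 & |f'(a)|,|f'(b)|\le 1,\\ a|f'(a)||f'(b)|^{1-s}g_2(\theta_i)^{1/q}+b|f'(b)||f'(a)|^{1-s}g_2(\theta_j)^{1/q}, & |f'(a)|,|f'(b)|\ge 1,\\ a|f'(a)|^{s}|f'(b)|^{1-s}g_2(\theta_i)^{1/q}+b|f'(b)|g_2(\theta_j)^{1/q}, & |f'(a)|\le 1\le|f'(b)|,\\ a|f'(a)|g_2(\theta_i)^{1/q}+b|f'(b)|^{s}|f'(a)|^{1-s}g_2(\theta_j)^{1/q}, & |f'(b)|\le 1\le|f'(a)|. \end{cases}$$
   Context: For an interval $J\subset(0,\infty)$ and a fixed $s\in(0,1]$, a function $h:J\to(0,\infty)$ is called $s$-geometrically convex on $J$ if $h(x^{t}y^{1-t})\le h(x)^{t^{s}}h(y)^{(1-t)^{s}}$ for all $x,y\in J$ and $t\in[0,1]$. (In particular, such a function takes strictly positive values, so here $f'$ does not vanish on $[a,b]$.) $L[a,b]$ denotes the Lebesgue integrable functions on $[a,b]$. *)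

(* Defs.v *)
From HB Require Import structures.
From mathcomp Require Import all_boot all_order all_algebra.
From mathcomp Require Import all_classical all_reals all_analysis.

Set Implicit Arguments.
Unset Strict Implicit.
Unset Printing Implicit Defensive.

Import Order.TTheory GRing.Theory Num.Theory.
Import numFieldNormedType.Exports.

Local Open Scope classical_set_scope.
Local Open Scope ring_scope.

(* Meant for an interval J of positive reals and 0 < s <= 1. The map h is total
   on R but only its values on J matter; its codomain (0, +oo) is the first
   conjunct. *)
Definition s_geom_convex (R : realType) (s : R) (J : set R) (h : R -> R) :=
  (forall x, J x -> 0 < h x) /\
  (forall x y t, J x -> J y -> 0 <= t <= 1 ->
     h (x `^ t * y `^ (1 - t)) <=
     h x `^ (t `^ s) * h y `^ ((1 - t) `^ s)).

Definition g2 (R : realType) (u : R) : R :=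
  if u == 1 then 1 else (u - 1) / ln u.

(* A and B stand for |f'(a)| and |f'(b)|, and u, v for the values of g2. The
   four mathematical cases overlap when A = 1 or B = 1; they then agree (see
   the lemmas below), so the order of the tests is immaterial. *)
Definition H2 (R : realType) (a b A B s q u v : R) : R :=
  if (A <= 1) && (B <= 1) then
    a * A `^ s * u `^ q^-1 + b * B `^ s * v `^ q^-1
  else if (1 <= A) && (1 <= B) then
    a * A * B `^ (1 - s) * u `^ q^-1 + b * B * A `^ (1 - s) * v `^ q^-1
  else if (A <= 1) && (1 <= B) then
    a * A `^ s * B `^ (1 - s) * u `^ q^-1 + b * B * v `^ q^-1
  else
    a * A * u `^ q^-1 + b * B `^ s * A `^ (1 - s) * v `^ q^-1.

Lemma H2_le1_le1 (R : realType) (a b A B s q u v : R) : A <= 1 -> B <= 1 ->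
  H2 a b A B s q u v = a * A `^ s * u `^ q^-1 + b * B `^ s * v `^ q^-1.
Proof. by rewrite /H2 => -> ->. Qed.

Lemma H2_ge1_ge1 (R : realType) (a b A B s q u v : R) : 1 <= A -> 1 <= B ->
  H2 a b A B s q u v =
  a * A * B `^ (1 - s) * u `^ q^-1 + b * B * A `^ (1 - s) * v `^ q^-1.
Proof.
rewrite /H2 => A1 B1; rewrite A1 B1.
case: ifP => // /andP[A2 B2].
have -> : A = 1 by apply/eqP; rewrite eq_le A1 A2.
have -> : B = 1 by apply/eqP; rewrite eq_le B1 B2.
by rewrite !powR1 !mulr1.
Qed.

Lemma H2_le1_ge1 (R : realType) (a b A B s q u v : R) : A <= 1 -> 1 <= B ->
  H2 a b A B s q u v =
  a * A `^ s * B `^ (1 - s) * u `^ q^-1 + b * B * v `^ q^-1.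
Proof.
rewrite /H2 => A1 B1; rewrite A1 B1 /= andbT.
case: ifP => [B2|_].
  have -> : B = 1 by apply/eqP; rewrite eq_le B1 B2.
  by rewrite !powR1 !mulr1.
case: ifP => // A2.
have -> : A = 1 by apply/eqP; rewrite eq_le A1 A2.
by rewrite !powR1 !mulr1.
Qed.

Lemma H2_ge1_le1 (R : realType) (a b A B s q u v : R) : 1 <= A -> B <= 1 ->
  H2 a b A B s q u v =
  a * A * u `^ q^-1 + b * B `^ s * A `^ (1 - s) * v `^ q^-1.
Proof.
rewrite /H2 => A1 B1; rewrite A1 B1 /= andbT.
case: ifP => [A2|->].
  have -> : A = 1 by apply/eqP; rewrite eq_le A1 A2.
  by rewrite !powR1 !mulr1.
case: ifP => [B2|_ //].
have -> : B = 1 by apply/eqP; rewrite eq_le B1 B2.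
by rewrite !powR1 !mulr1.
Qed.

(* Main.v *)
(** In the variable [u = ln x] the function [f] becomes [phi u = f (expR u)],
    with [phi' = x f'(x)], and [M] is the mean of [phi]. Convexity of [|f'|^q]
    bounds [|phi'|] by an exponential [C X (Y/X)^t] in the affine parameter [t]
    running from [ln a] to [ln b], where [X = a A^s], [Y = b B^s] and
    [C = max(1, A)^(1-s) max(1, B)^(1-s)]; this [C] unifies the four cases of
    [H2]. For an end [e] of a segment, [phi e] minus the mean of [phi] is the
    integral of [phi'] against a linear weight, and Hölder's inequality bounds
    it. The first estimate averages this over the two ends of [ln a, ln b]; the
    second applies it to the two halves of the segment at their common end. *)
Require Import Defs.
From HB Require Import structures.
From mathcomp Require Import all_boot all_order all_algebra.
From mathcomp Require Import all_classical all_reals all_analysis.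
From mathcomp Require Import ring lra.

Set Implicit Arguments.
Unset Strict Implicit.
Unset Printing Implicit Defensive.

Import Order.TTheory GRing.Theory Num.Theory.
Import numFieldNormedType.Exports.

Local Open Scope classical_set_scope.
Local Open Scope ring_scope.

(** * Calculus tools and a Hölder bound at one end of a segment *)

(** Stands in for integrating the bound on [dW]. When [|e| <= 1], the function [U - e W] has a
    nonnegative derivative, so by the mean value theorem its increment is nonnegative; [e = 1] and
    [e = -1] together give the absolute value. *)
Lemma le_increment_of_derive (R : realType) (W dW U dU : R -> R) (a b : R) :
  a <= b ->
  (forall t : R, t \in `]a, b[ -> is_derive t 1 W (dW t)) ->
  (forall t : R, t \in `]a, b[ -> is_derive t 1 U (dU t)) ->
  {within `[a, b], continuous W} -> {within `[a, b], continuous U} ->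
  (forall t, t \in `[a, b] -> `|dW t| <= dU t) ->
  `|W b - W a| <= U b - U a.
Proof.
move=> ab dWP dUP Wc Uc le_dW.
have key (e : R) : `|e| <= 1 -> e * (W b - W a) <= U b - U a.
  move=> e1.
  have dP (t : R) : t \in `]a, b[ -> is_derive t 1 (U - cst e * W) (dU t - e * dW t).
    move=> tab; have := dUP t tab; have := dWP t tab => ? ?.
    apply: is_deriveB; apply: (is_derive_eq (is_deriveM _ _)).
    by rewrite /cst /= scaler0 addr0.
  have ecW : {within `[a, b], continuous (cst e * W)}.
    by move=> x; apply: continuousM; [exact: cst_continuous|exact: Wc].
  have dc : {within `[a, b], continuous (U \- cst e * W)}.
    by move=> x; apply: continuousB; [exact: Uc|exact: ecW].
  have [c cab] := MVT_segment ab dP dc.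
  have : 0 <= (dU c - e * dW c) * (b - a).
    rewrite mulr_ge0 ?subr_ge0// (le_trans _ (le_dW c cab))//.
    by rewrite (le_trans (ler_norm _))// normrM ler_piMl.
  move=> /[swap] <-; rewrite !fctE /= => h.
  rewrite -subr_ge0; move: h; congr (_ <= _).
  by rewrite /cst /=; ring.
rewrite ler_norml; apply/andP; split; last first.
  by have := key 1; rewrite normr1 mul1r; exact.
by have := key (-1); rewrite normrN normr1 mulN1r lerNl; exact.
Qed.

Lemma g2_gt0 (R : realType) (u : R) : 0 < u -> 0 < g2 u.
Proof.
rewrite /g2 => u0; case: (ltgtP u 1) => //= u1.
  by rewrite nmulr_rgt0 ?subr_lt0// invr_lt0 ln_lt0// u0.
by rewrite mulr_gt0 ?subr_gt0// invr_gt0 ln_gt0.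
Qed.

(** This is how [g2] enters: [g2 (expR c)] is the integral of [expR (c * t)] over [0, 1]. The
    primitive is [expR (c * t) / c], or [t] when [c = 0]. *)
Lemma g2_expR_primitive (R : realType) (c : R) : exists2 E : R -> R,
  (forall t : R, is_derive t 1 E (expR (c * t))) & E 1 - E 0 = g2 (expR c).
Proof.
have [->|c0] := eqVneq c 0.
  exists id => [t|]; first by apply: is_derive_eq; rewrite mul0r expR0.
  by rewrite /g2 expR0 eqxx subr0.
exists (cst c^-1 * (expR \o (cst c * id))) => [t|].
  apply: is_derive_eq.
  by rewrite /cst !fctE /= !(scaler0, addr0, add0r); rewrite /GRing.scale /=; field.
rewrite !fctE /cst /= mulr0 mulr1 expR0 /g2 expRK -expR0 (inj_eq (@expR_inj R)).
by rewrite (negbTE c0) expR0 mulrBl mulrC [1 / c]mulrC.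
Qed.

Lemma powRV (R : realType) (x r : R) : 0 <= x -> x^-1 `^ r = (x `^ r)^-1.
Proof. by move=> x0; rewrite -powR_inv1// powRAC powR_inv1 ?powR_ge0. Qed.

Lemma is_derive_continuous (R : realType) (f : R -> R) (x df : R) :
  is_derive x 1 f df -> {for x, continuous f}.
Proof.
by move=> [fd _]; apply/differentiable_continuous/derivable1_diffP.
Qed.

Lemma within_powR_continuous (R : realType) (r : R) : 0 < r ->
  {within `[0, 1], continuous (fun t : R => t `^ r)}.
Proof.
move=> r0; apply/continuous_within_itvP => //; split.
- move=> t; rewrite in_itv /= => /andP[t0 _].
  exact: (is_derive_continuous (is_derive1_powR r t0)).
(* The power rule needs a positive base, so the end [0] is treated as a limit. *)
- by rewrite powR0 ?gt_eqF//; exact: powR_cvg0.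
- apply: cvg_at_left_filter.
  exact: (is_derive_continuous (is_derive1_powR r ltr01)).
Qed.

(* [psi 1 - (Psi 1 - Psi 0)] is [\int_0^1 t * psi' t dt]; instead of integrating
   [psi'], compare [t * psi t - Psi t] with a primitive of the bound that
   Young's inequality gives for [t * expR (c * t)], with the scaling for which
   Young integrates to Hölder. *)
Lemma end_minus_mean_le (R : realType) (psi dpsi Psi : R -> R) (K c p q : R) :
  0 < p -> 0 < q -> p^-1 + q^-1 = 1 -> 0 <= K ->
  (forall t : R, t \in `[0, 1] -> is_derive t 1 psi (dpsi t)) ->
  (forall t : R, t \in `[0, 1] -> is_derive t 1 Psi (psi t)) ->
  (forall t, t \in `[0, 1] -> `|dpsi t| <= K * expR (c * t)) ->
  `|psi 1 - (Psi 1 - Psi 0)| <=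
    (p + 1)^-1 `^ p^-1 * (K * g2 (expR (c * q)) `^ q^-1).
Proof.
move=> p0 q0 pq K0 psiP PsiP dpsi_le.
have p10 : 0 < p + 1 by rewrite addr_gt0.
have g0 : 0 < g2 (expR (c * q)) by rewrite g2_gt0 ?expR_gt0.
have [E EP E1] := g2_expR_primitive (c * q).
set g := g2 _ in g0 E1 *.
(* On [0, 1], [N1] is the L^p norm of [t] and [N2] is the L^q norm of [expR (c * t)]. *)
set N1 := (p + 1)^-1 `^ p^-1; set N2 := g `^ q^-1.
have N10 : 0 < N1 by rewrite powR_gt0 ?invr_gt0.
have N20 : 0 < N2 by rewrite powR_gt0.
have N1p : N1 `^ p = (p + 1)^-1.
  by rewrite -powRrM mulVf ?gt_eqF// powRr1// invr_ge0 ltW.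
have N2q : N2 `^ q = g by rewrite -powRrM mulVf ?gt_eqF// powRr1// ltW.
(* A primitive of [K N1 N2 ((t / N1)^p / p + (expR (c t) / N2)^q / q)], with the coefficients
   simplified by [N1^p = 1 / (p + 1)] and [N2^q = g]. *)
set U : R -> R := cst (K * N1 * N2 / p) * (fun t : R => t `^ (p + 1))
                  + cst (K * N1 * N2 / (g * q)) * E.
set dU : R -> R := fun t => K * N1 * N2 / p * ((p + 1) * t `^ p)
                  + K * N1 * N2 / (g * q) * expR (c * q * t).
have UP (t : R) : t \in `]0, 1[ -> is_derive t 1 U (dU t).
  rewrite in_itv /= => /andP[t0 _].
  have ? := EP t; have ? := is_derive1_powR (p + 1) t0.
  apply: is_deriveD; apply: (is_derive_eq (is_deriveM _ _));
    by rewrite /cst /= !scaler0 !addr0 ?addrK.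
have Uc : {within `[0, 1], continuous U}.
  move=> t; apply: continuousD.
    apply: continuousM; first exact: cst_continuous.
    exact: within_powR_continuous p10 t.
  apply: continuousM; first exact: cst_continuous.
  apply: continuous_subspaceT => x.
  exact: is_derive_continuous (EP x).
set W : R -> R := id * psi - Psi.
have WP (t : R) : t \in `[0, 1] -> is_derive t 1 W (t * dpsi t).
  move=> t01; have ? := psiP t t01; have ? := PsiP t t01.
  apply: is_derive_eq; rewrite /GRing.scale /=; ring.
have Wc : {within `[0, 1], continuous W}.
  by apply: derivable_within_continuous => t /WP[].
have le_dW t : t \in `[0, 1] -> `|t * dpsi t| <= dU t.
  move=> t01; have /andP[t0 _] : 0 <= t <= 1 by move: t01; rewrite in_itv.
  rewrite normrM ger0_norm//.
  apply: (le_trans (ler_wpM2l t0 (dpsi_le t t01))).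
  have -> : t * (K * expR (c * t)) =
      K * N1 * N2 * ((t / N1) * (expR (c * t) / N2)).
    by field; rewrite ?gt_eqF.
  have -> : dU t = K * N1 * N2 *
      ((t / N1) `^ p / p + (expR (c * t) / N2) `^ q / q).
    rewrite !powRM ?invr_ge0 ?expR_ge0// 1?ltW//.
    rewrite (powRV _ (ltW N10)) (powRV _ (ltW N20)) N1p N2q invrK -expRM /dU.
    rewrite (_ : c * q * t = c * t * q); last by ring.
    by field; rewrite ?gt_eqF.
  apply: ler_wpM2l; first by rewrite !mulr_ge0// ltW.
  by apply: conjugate_powR => //; rewrite divr_ge0 ?expR_ge0// ltW.
have sub t : t \in `]0, 1[ -> t \in `[0, 1] :> Prop.
  exact: subset_itv_oo_cc.
have := le_increment_of_derive ler01 (fun t h => WP t (sub _ t h)) UP Wc Uc le_dW.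
have -> : W 1 - W 0 = psi 1 - (Psi 1 - Psi 0).
  by rewrite /W !fctE /=; ring.
move=> /le_trans; apply; rewrite le_eqVlt; apply/orP; left; apply/eqP.
rewrite /U !fctE /cst /= powR1 powR0 ?gt_eqF//.
transitivity (K * N1 * N2 / p + K * N1 * N2 / (g * q) * (E 1 - E 0)); first by ring.
rewrite E1; transitivity (K * N1 * N2 * (p^-1 + q^-1)).
  by field; rewrite ?gt_eqF.
by rewrite pq; ring.
Qed.

(** Reparametrises by [y t = expR (u + r * t * h)] and applies [end_minus_mean_le] to [r * h] times
    [f \o y], which is the derivative of [F \o y]. A ratio [r < 1] keeps only the initial part of
    the segment, and a negative [h] runs it backwards, so either end can be reached. *)
Lemma end_minus_log_mean_le (R : realType) (f F : R -> R)
    (u h r K k p q c d w : R) :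
  0 < p -> 0 < q -> p^-1 + q^-1 = 1 -> 0 <= K -> h != 0 -> 0 < r <= 1 ->
  (forall t : R, t \in `[0, 1] -> let x := expR (u + t * h) in
     [/\ derivable f x 1, is_derive x 1 F (f x / x) &
         x * `|derive1 f x| <= K * expR (k * t)]) ->
  expR u = c -> expR (u + r * h) = d -> expR (r * k * q) = w ->
  `|f d - (F d - F c) / (r * h)| <=
    r * `|h| * ((p + 1)^-1 `^ p^-1 * (K * g2 w `^ q^-1)).
Proof.
move=> p0 q0 pq K0 h0 /andP[r0 r1] H <- <- <-.
have rh0 : 0 < `|r * h| by rewrite normr_gt0 mulf_neq0// gt_eqF.
pose y : R -> R := expR \o (cst u + cst (r * h) * id).
have yE t : y t = expR (u + r * t * h).
  by rewrite /y /= !fctE /cst /=; congr expR; ring.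
have yP (t : R) : is_derive t 1 y (y t * (r * h)).
  have vP := is_deriveD (is_derive_cst u t 1)
    (is_deriveM (is_derive_cst (r * h) t 1) (is_derive_id t 1)).
  apply: (is_derive_eq (is_derive1_comp (is_derive_expR _) vP)).
  by rewrite /cst /= scaler0 addr0 add0r /GRing.scale /= mulr1.
have rt01 t : t \in `[0, 1] -> r * t \in `[0, 1].
  rewrite !in_itv /= => /andP[t0 t1].
  by rewrite (mulr_ge0 (ltW r0))//= mulr_ile1// ltW.
have hK : 0 <= (r * h) ^+ 2 * K by rewrite mulr_ge0 ?sqr_ge0.
have := @end_minus_mean_le R (cst (r * h) * (f \o y))
  (fun t => (r * h) ^+ 2 * (y t * derive1 f (y t))) (F \o y)
  ((r * h) ^+ 2 * K) (r * k) p q p0 q0 pq hK.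
have psiP (t : R) : t \in `[0, 1] -> is_derive t 1 (cst (r * h) * (f \o y))
    ((r * h) ^+ 2 * (y t * derive1 f (y t))).
  move=> /rt01 /H /=; rewrite -yE => -[/derivableP fP _ _].
  have := is_derive1_comp fP (yP t) => ?.
  apply: (is_derive_eq (is_deriveM _ _)).
  by rewrite derive1E scaler0 addr0 /cst /GRing.scale /=; ring.
have PsiP (t : R) : t \in `[0, 1] ->
    is_derive t 1 (F \o y) ((cst (r * h) * (f \o y)) t).
  move=> /rt01 /H /=; rewrite -yE => -[_ FP _].
  apply: (is_derive_eq (is_derive1_comp FP (yP t))).
  have y0 : y t != 0 by rewrite gt_eqF// yE expR_gt0.
  by rewrite !fctE /cst /=; field.
have dpsi_le (t : R) : t \in `[0, 1] ->
    `|(r * h) ^+ 2 * (y t * derive1 f (y t))| <=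
    (r * h) ^+ 2 * K * expR (r * k * t).
  move=> /rt01 /H /=; rewrite -yE => -[_ _].
  rewrite normrM ger0_norm ?sqr_ge0// normrM (@ger0_norm _ (y t)); last first.
    by rewrite yE expR_ge0.
  move=> le_f; rewrite -[leRHS]mulrA; apply: ler_wpM2l; first exact: sqr_ge0.
  by rewrite (_ : r * k * t = k * (r * t))//; ring.
move=> /(_ psiP PsiP dpsi_le); rewrite !fctE /cst /= !yE mulr1 mulr0 mul0r addr0.
set fd := f _; set Fd := F _; set Fc := F _; set P := _ `^ p^-1.
set Q := _ `^ q^-1; move=> le_rh.
rewrite -(ler_pM2l rh0) -normrM.
have -> : r * h * (fd - (Fd - Fc) / (r * h)) = r * h * fd - (Fd - Fc).
  by field; rewrite h0 gt_eqF.
apply: (le_trans le_rh); rewrite le_eqVlt; apply/orP; left; apply/eqP.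
rewrite normrM (ger0_norm (ltW r0)) exprMn -(real_normK (num_real h)).
ring.
Qed.

(** * From s-geometric convexity to an exponential bound *)

(** Source of the factor [C]. If [A <= 1], powers of [A] decrease in the exponent and
    [s t <= t <= t^s]. If [A > 1] and [s < 1], Young's inequality with exponents [1/s] and
    [1/(1 - s)], applied to [t^s] and [1], gives [t^s <= s t + (1 - s)]. *)
Lemma powR_max1_le (R : realType) (A s t : R) :
  0 < A -> 0 < s <= 1 -> 0 <= t <= 1 ->
  A `^ (t `^ s) <= Num.max 1 A `^ (1 - s) * A `^ (s * t).
Proof.
move=> A0 /andP[s0 s1] /andP[t0 t1]; have [A1|A1] := leP A 1.
  rewrite powR1 mul1r; apply: ger_powR; first by rewrite A0 A1.
  have [->|tn0] := eqVneq t 0; first by rewrite mulr0 powR_ge0.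
  have tp : 0 < t by rewrite lt_neqAle eq_sym tn0.
  by rewrite (@le_trans _ _ t)// ?ler_piMl// ger1_powR ?tp.
rewrite -powRD; last by rewrite (gt_eqF A0) implybT.
apply: ler_powR; first exact: ltW.
have [->|sn1] := eqVneq s 1; first by rewrite subrr add0r mul1r powRr1.
have s1p : 0 < 1 - s by rewrite subr_gt0 lt_neqAle sn1.
have := @conjugate_powR R (t `^ s) 1 s^-1 (1 - s)^-1 (powR_ge0 _ _) ler01.
rewrite !invr_gt0 !invrK -powRrM divff ?gt_eqF// powRr1// powR1.
rewrite mulr1 mul1r [t * s]mulrC [_ + s * t]addrC; apply=> //.
by rewrite addrC subrK.
Qed.

(** Each maximum is [1] or the derivative value itself, and in the latter case [A^(1-s) A^s = A]
    restores the first power. *)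
Lemma H2_max1E (R : realType) (a b A B s q u v : R) : 0 < A -> 0 < B ->
  H2 a b A B s q u v =
  Num.max 1 A `^ (1 - s) * Num.max 1 B `^ (1 - s) *
  (a * A `^ s * u `^ q^-1 + b * B `^ s * v `^ q^-1).
Proof.
have powE (X : R) : 0 < X -> X = X `^ (1 - s) * X `^ s.
  move=> X0; rewrite -powRD; last by rewrite (gt_eqF X0) implybT.
  by rewrite subrK powRr1 ?ltW.
move=> A0 B0; have [A1|/ltW A1] := leP A 1; have [B1|/ltW B1] := leP B 1.
- by rewrite H2_le1_le1// powR1 !mul1r.
- rewrite H2_le1_ge1// powR1 mul1r [b * B]mulrC {2}(powE B)//; ring.
- rewrite H2_ge1_le1// powR1 mulr1 [a * A]mulrC {1}(powE A)//; ring.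
- rewrite H2_ge1_ge1// [a * A]mulrC [b * B]mulrC {1}(powE A)// {2}(powE B)//.
  ring.
Qed.

(** The point is [z = x^(1-t) y^t]. Convexity bounds [g z] by [g x] to the [(1-t)^s] times [g y] to
    the [t^s]; [powR_max1_le] makes both exponents linear in [t], and the factor [z] completes them
    to powers of [X] and [Y]. *)
Lemma s_geom_convex_mul_le (R : realType) (s q : R) (J : set R) (g : R -> R)
    (x y t : R) :
  0 < q -> 0 < s <= 1 -> (forall z, 0 <= g z) ->
  s_geom_convex s J (fun z => g z `^ q) -> J x -> J y -> 0 < x -> 0 < y ->
  0 <= t <= 1 ->
  expR (ln x + t * (ln y - ln x)) * g (expR (ln x + t * (ln y - ln x))) <=
  Num.max 1 (g x) `^ (1 - s) * Num.max 1 (g y) `^ (1 - s) * (x * g x `^ s) *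
    expR ((ln (y * g y `^ s) - ln (x * g x `^ s)) * t).
Proof.
move=> q0 s01 g0 [gq0 gconv] Jx Jy x0 y0 t01.
set z := expR (ln x + _); set X := x * _; set Y := y * g y `^ s.
have gpos w : J w -> 0 < g w.
  move=> Jw; rewrite lt_neqAle eq_sym g0 andbT; apply/eqP => gw.
  by have := gq0 w Jw; rewrite gw powR0 ?ltxx// gt_eqF.
have gx := gpos x Jx; have gy := gpos y Jy.
have t01' : 0 <= 1 - t <= 1 by move: t01; lra.
have zE : z = x `^ (1 - t) * y `^ t.
  by rewrite /powR (gt_eqF x0) (gt_eqF y0) -expRD /z; congr expR; ring.
have gz : g z <= g x `^ ((1 - t) `^ s) * g y `^ (t `^ s).
  have := gconv x y (1 - t) Jx Jy t01'; rewrite subKr -zE.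
  rewrite powRAC [(g y `^ q) `^ _]powRAC -powRM ?powR_ge0//.
  (* Taking q-th roots, by contraposition: the power [q] is strictly increasing. *)
  rewrite leNgt => /negP le_q; rewrite leNgt; apply/negP => lt_g; apply: le_q.
  by apply: gt0_ltr_powR; rewrite // ?nnegrE ?mulr_ge0 ?powR_ge0.
have -> : Num.max 1 (g x) `^ (1 - s) * Num.max 1 (g y) `^ (1 - s) * X *
    expR ((ln Y - ln X) * t) = z *
    ((Num.max 1 (g x) `^ (1 - s) * g x `^ (s * (1 - t))) *
     (Num.max 1 (g y) `^ (1 - s) * g y `^ (s * t))).
  have X0 : 0 < X by rewrite mulr_gt0 ?powR_gt0.
  have Y0 : 0 < Y by rewrite mulr_gt0 ?powR_gt0.
  have E : z * g x `^ (s * (1 - t)) * g y `^ (s * t) =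
            X * expR ((ln Y - ln X) * t).
    rewrite -{1}(lnK X0) -expRD /X /Y !lnM ?posrE ?powR_gt0// !ln_powR.
    rewrite /powR (gt_eqF gx) (gt_eqF gy) -!expRD; congr expR; ring.
  by rewrite -[LHS]mulrA -E; ring.
have z0 : 0 <= z by exact: expR_ge0.
apply: ler_wpM2l => //; apply: (le_trans gz).
by apply: ler_pM; rewrite ?powR_ge0//; apply: powR_max1_le.
Qed.

(** * A primitive on a neighbourhood of the segment *)

(** Integrating from [a' < a], with room left up to [b' > b], makes the primitive differentiable
    from both sides at [a] and [b] as well. *)
Lemma Rintegral_primitive (R : realType) (g : R -> R) (a' a b b' : R) :
  a' < a -> a < b -> b < b' ->
  (forall x, a' <= x <= b' -> {for x, continuous g}) ->
  exists2 F : R -> R, (forall x, a <= x <= b -> is_derive x 1 F (g x)) &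
    \int[@lebesgue_measure R]_(x in `[a, b]) g x = F b - F a.
Proof.
move=> a'a ab bb' gc.
have ig : (@lebesgue_measure R).-integrable `[a', b'] (EFin \o g).
  apply: continuous_compact_integrable; first exact: segment_compact.
  by apply: continuous_in_subspaceT => x; rewrite inE /= in_itv; exact: gc.
exists (fun x => \int[@lebesgue_measure R]_(t in `[a', x]) g t) => [x /andP[ax xb]|].
  have [||/derivableP FP FE] := continuous_FTC1_closed (le_lt_trans xb bb') ig.
  - exact: lt_le_trans ax.
  - by apply: gc; rewrite !ltW// ?(lt_le_trans a'a)// (le_lt_trans xb).
  by rewrite -FE derive1E.
rewrite Rintegral_itvB ?bnd_simp ?ltW//; last first.
  by apply: integrableS ig => //; apply: subset_itvl; rewrite bnd_simp ltW.
rewrite Rintegral_itv_obnd_cbnd//.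
apply: integrableS ig => //; apply: subset_itvScc; rewrite bnd_simp; exact/ltW.
Qed.

Lemma interval_interior_segment (R : realType) (I : set R) (a b : R) :
  is_interval I -> interior I a -> interior I b ->
  exists a' b', [/\ a' < a, b < b' & forall x, a' <= x <= b' -> interior I x].
Proof.
move=> Iitv Ia Ib.
have nb (c : R) : interior I c ->
    exists2 e : R, 0 < e & interior I (c - e) /\ interior I (c + e).
  move=> Ic; have /nbhs_ballP[e /= e0 eI] := open_nbhs_nbhs
    (conj (@open_interior _ I) Ic).
  have e20 : 0 < e / 2 by rewrite divr_gt0.
  exists (e / 2) => //; split; apply: eI; rewrite /ball /=.
    by rewrite subKr gtr0_norm// gtr_pMr// invf_lt1// ltr1n.
  by rewrite opprD addNKr normrN gtr0_norm// gtr_pMr// invf_lt1// ltr1n.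
have [e e0 [Ia' _]] := nb a Ia; have [d d0 [_ Ib']] := nb b Ib.
exists (a - e), (b + d); split; [by rewrite gtrBl|by rewrite ltrDl|].
(* The two ends are interior by choice; any other point has the open interval between them as a
   neighbourhood, contained in [I] by convexity. *)
move=> x /andP[]; rewrite le_eqVlt => /predU1P[<- //|ax].
rewrite le_eqVlt => /predU1P[-> //|xb].
have xI : x \in `]a - e, b + d[ by rewrite in_itv /= ax.
apply: filterS (near_in_itvoo xI) => y; rewrite in_itv /= => /andP[ay yb].
by apply: (Iitv _ _ (interior_subset Ia') (interior_subset Ib')); rewrite !ltW.
Qed.

(** * Both estimates from the exponential bound, and the theorem *)

Lemma log_mean_bounds (R : realType) (f F : R -> R)
    (a b h C X Y p q k theta theta' : R) :
  0 < p -> 0 < q -> p^-1 + q^-1 = 1 -> 0 < a -> 0 < b ->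
  h = ln b - ln a -> 0 < h -> 0 <= C -> 0 < X -> 0 < Y ->
  (forall t : R, t \in `[0, 1] -> let x := expR (ln a + t * h) in
     [/\ derivable f x 1, is_derive x 1 F (f x / x) &
         x * `|derive1 f x| <= C * X * expR ((ln Y - ln X) * t)]) ->
  k = (p + 1)^-1 `^ p^-1 -> theta = (Y / X) `^ q -> theta' = (X / Y) `^ q ->
  `|(f a + f b) / 2 - h^-1 * (F b - F a)| <= 2^-1 * h * k *
    (C * (X * g2 theta `^ q^-1 + Y * g2 theta' `^ q^-1)) /\
  `|f (Num.sqrt (a * b)) - h^-1 * (F b - F a)| <= 4^-1 * h * k *
    (C * (X * g2 (Num.sqrt theta) `^ q^-1 + Y * g2 (Num.sqrt theta') `^ q^-1)).
Proof.
move=> p0 q0 pq a0 b0 hE h0 C0 X0 Y0 fwd kE thE thE'.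
(* The ratio [r = 1] will produce [theta], and [r = 1/2] its square root. *)
have rootE (Z W r : R) : 0 < Z -> 0 < W ->
    expR (r * (ln W - ln Z) * q) = ((W / Z) `^ q) `^ r.
  move=> Z0 W0; rewrite -powRrM /powR gt_eqF ?divr_gt0// ln_div ?posrE//.
  by congr expR; ring.
have th1 : expR (1 * (ln Y - ln X) * q) = theta.
  by rewrite rootE// powRr1 ?powR_ge0.
have th1' : expR (1 * (ln X - ln Y) * q) = theta'.
  by rewrite rootE// powRr1 ?powR_ge0.
have th2 : expR (2^-1 * (ln Y - ln X) * q) = Num.sqrt theta.
  by rewrite rootE// powR12_sqrt ?powR_ge0// thE.
have th2' : expR (2^-1 * (ln X - ln Y) * q) = Num.sqrt theta'.
  by rewrite rootE// powR12_sqrt ?powR_ge0// thE'.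
have hn0 : h != 0 by rewrite gt_eqF.
have nhn0 : - h != 0 by rewrite oppr_eq0.
(* The same bound read from [b] towards [a]: since [X (Y/X)^(1-t) = Y (X/Y)^t], [X] and [Y] trade
   places. *)
have bwd (t : R) : t \in `[0, 1] -> let x := expR (ln b + t * (- h)) in
     [/\ derivable f x 1, is_derive x 1 F (f x / x) &
         x * `|derive1 f x| <= C * Y * expR ((ln X - ln Y) * t)].
  rewrite in_itv => t01.
  have E : ln a + (1 - t) * h = ln b + t * - h by rewrite hE; ring.
  have EY : C * X * expR ((ln Y - ln X) * (1 - t)) =
            C * Y * expR ((ln X - ln Y) * t).
    rewrite -!mulrA -{1}(lnK X0) -{2}(lnK Y0) -!expRD.
    by congr (_ * expR _); ring.
  have t01' : 1 - t \in `[0, 1] by rewrite in_itv /=; move: t01 => /=; lra.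
  by have := fwd (1 - t) t01'; rewrite EY E.
have CX0 : 0 <= C * X by rewrite mulr_ge0// ltW.
have CY0 : 0 <= C * Y by rewrite mulr_ge0// ltW.
have lnaK : expR (ln a) = a by rewrite lnK ?posrE.
have lnbK : expR (ln b) = b by rewrite lnK ?posrE.
have fwd_le r d w r01 := @end_minus_log_mean_le R f F (ln a) h r (C * X)
  (ln Y - ln X) p q a d w p0 q0 pq CX0 hn0 r01 fwd lnaK.
have bwd_le r d w r01 := @end_minus_log_mean_le R f F (ln b) (- h) r (C * Y)
  (ln X - ln Y) p q b d w p0 q0 pq CY0 nhn0 r01 bwd lnbK.
split.
  have r01 : 0 < (1 : R) <= 1 by rewrite ltr01 lexx.
  have Eb : expR (ln a + 1 * h) = b by rewrite mul1r hE subrKC.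
  have Ea : expR (ln b + 1 * - h) = a by rewrite mul1r hE opprB subrKC.
  have := lerD (fwd_le 1 b _ r01 Eb th1) (bwd_le 1 a _ r01 Ea th1').
  rewrite -kE !mul1r normrN (gtr0_norm h0).
  set u := f b - _; set v := f a - _ => le_uv.
  (* Both directions have the same mean, so averaging [u] and [v] averages the end values only. *)
  rewrite (_ : _ - _ = 2^-1 * (u + v)); last by rewrite /u /v; field.
  rewrite normrM gtr0_norm ?invr_gt0// -!mulrA ler_pM2l ?invr_gt0//.
  apply: (le_trans (ler_normD _ _)); apply: (le_trans le_uv).
  by rewrite le_eqVlt; apply/orP; left; apply/eqP; ring.
have r01 : 0 < (2^-1 : R) <= 1 by rewrite invr_gt0 ltr0n/= invf_le1// ler1n.
have Em : expR (ln a + 2^-1 * h) = Num.sqrt (a * b).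
  rewrite -powR12_sqrt ?mulr_ge0 ?ltW// /powR gt_eqF ?mulr_gt0//.
  by rewrite lnM ?posrE//; congr expR; rewrite hE; field.
have Em' : expR (ln b + 2^-1 * - h) = Num.sqrt (a * b).
  by rewrite -Em; congr expR; rewrite hE; field.
move: (Num.sqrt theta) (Num.sqrt theta') th2 th2' => rho rho' th2 th2'.
have := lerD (fwd_le _ _ _ r01 Em th2) (bwd_le _ _ _ r01 Em' th2').
rewrite -kE normrN (gtr0_norm h0); set m := Num.sqrt (a * b).
set u := f m - _; set v := f m - _ => le_uv.
(* Here the means over the two halves average to the mean over the whole segment. *)
rewrite (_ : _ - _ = 2^-1 * (u + v)); last by rewrite /u /v; field.
rewrite normrM gtr0_norm ?invr_gt0//.
(* One half comes from the averaging, the other from the length ratio [r = 1/2]. *)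
rewrite (_ : 4^-1 = 2^-1 * 2^-1 :> R); last by field.
rewrite -!mulrA ler_pM2l ?invr_gt0//.
apply: (le_trans (ler_normD _ _)); apply: (le_trans le_uv).
by rewrite le_eqVlt; apply/orP; left; apply/eqP; ring.
Qed.

Theorem theorem5 (R : realType) (I : set R) (f : R -> R) (a b q s : R)
    (I_itv : is_interval I)
    (I_pos : forall x, I x -> 0 < x)
    (f_pos : forall x, I x -> 0 < f x)
    (f_diff : forall x, (interior I) x -> derivable f x 1)
    (a_in : (interior I) a) (b_in : (interior I) b) (a_lt_b : a < b)
    (f'_int : (@lebesgue_measure R).-integrable `[a, b] (EFin \o derive1 f))
    (q_gt1 : 1 < q) (s_gt0 : 0 < s) (s_le1 : s <= 1)
    (f'_conv : s_geom_convex s `[a, b] (fun x => `|derive1 f x| `^ q)) :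
  let A := `|derive1 f a| in
  let B := `|derive1 f b| in
  let M := (ln b - ln a)^-1 *
             \int[@lebesgue_measure R]_(x in `[a, b]) (f x / x) in
  let theta1 := ((b * B `^ s) / (a * A `^ s)) `^ q in
  let theta2 := ((a * A `^ s) / (b * B `^ s)) `^ q in
  let theta3 := Num.sqrt theta1 in
  let theta4 := Num.sqrt theta2 in
  `|(f a + f b) / 2 - M| <=
    2^-1 * ln (b / a) * ((q - 1) / (2 * q - 1)) `^ (1 - q^-1) *
      H2 a b A B s q (g2 theta1) (g2 theta2) /\
  `|f (Num.sqrt (a * b)) - M| <=
    4^-1 * ln (b / a) * ((q - 1) / (2 * q - 1)) `^ (1 - q^-1) *
      H2 a b A B s q (g2 theta3) (g2 theta4).
Proof.
move=> A B M theta1 theta2 theta3 theta4.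
have a0 : 0 < a := I_pos a (interior_subset a_in).
have b0 : 0 < b := I_pos b (interior_subset b_in).
have [a' [b' [a'a bb' IS]]] := interval_interior_segment I_itv a_in b_in.
have IabI x : a <= x <= b -> interior I x.
  by move=> /andP[ax xb]; apply: IS; rewrite !ltW// ?(lt_le_trans a'a)//
    (le_lt_trans xb).
have [x a'xb'|F FP FM] :=
    Rintegral_primitive (g := fun x => f x / x) a'a a_lt_b bb'.
  have Ix := IS x a'xb'; have x0 := I_pos x (interior_subset Ix).
  apply: cvgM; first by apply/differentiable_continuous/derivable1_diffP/f_diff.
  by apply: cvgV; [rewrite gt_eqF|].
rewrite /M FM => {M FM}.
have q0 : 0 < q by exact: lt_trans q_gt1.
have q10 : 0 < q - 1 by rewrite subr_gt0.
(* The exponent conjugate to [q]; with it, [1 / (p + 1)] is [(q - 1) / (2 q - 1)] and [1 / p] is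
   [1 - 1 / q]. *)
have p0 : 0 < q / (q - 1) by rewrite divr_gt0.
have pq : (q / (q - 1))^-1 + q^-1 = 1 by field; rewrite !gt_eqF.
have kE : (q / (q - 1) + 1)^-1 `^ (q / (q - 1))^-1 =
    ((q - 1) / (2 * q - 1)) `^ (1 - q^-1).
  have q21 : 0 < 2 * q - 1 by lra.
  by congr (_ `^ _); field; rewrite !gt_eqF//; lra.
have s01 : 0 < s <= 1 by rewrite s_gt0 s_le1.
have [conv_pos _] := f'_conv.
have aab : [set` `[a, b]] a by rewrite /= in_itv /= lexx ltW.
have bab : [set` `[a, b]] b by rewrite /= in_itv /= lexx ltW.
have pos z : [set` `[a, b]] z -> 0 < `|derive1 f z|.
  move=> /conv_pos fz0; rewrite lt_neqAle normr_ge0 andbT eq_sym.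
  by apply: contraTneq fz0 => ->; rewrite powR0 ?ltxx// gt_eqF.
have A0 : 0 < A := pos a aab; have B0 : 0 < B := pos b bab.
have h0 : 0 < ln b - ln a by rewrite subr_gt0 ltr_ln ?posrE.
have C0 : 0 <= Num.max 1 A `^ (1 - s) * Num.max 1 B `^ (1 - s).
  by rewrite mulr_ge0 ?powR_ge0.
have X0 : 0 < a * A `^ s by rewrite mulr_gt0 ?powR_gt0.
have Y0 : 0 < b * B `^ s by rewrite mulr_gt0 ?powR_gt0.
rewrite !H2_max1E// ln_div ?posrE// -kE.
apply: (log_mean_bounds p0 q0 pq a0 b0 erefl h0 C0 X0 Y0) => // t.
rewrite in_itv /= => t01; have /andP[t0 t1] := t01.
have xab : a <= expR (ln a + t * (ln b - ln a)) <= b.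
  rewrite -[X in X <= _ <= _](lnK a0) -[X in _ <= _ <= X](lnK b0) !ler_expR.
  by rewrite lerDl mulr_ge0 ?(ltW h0)//= -lerBrDl ler_piMl// ltW.
split; [exact/f_diff/IabI|exact: FP|].
exact: (s_geom_convex_mul_le q0 s01 (fun z => normr_ge0 (derive1 f z)) f'_conv).
Qed.
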